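(* Let $n\geq 3$, let $F_q$ be the finite field with $q$ elements, and let $R=M_n(F_q)$ be the ring of $n\times n$ matrices over $F_q$. There is a subset $D\subseteq V(\varTheta(R))$ with $\binom{n}{1}_q$ elements such that: (i) $D$ is a dominating set for $\overline{\varTheta}(R)\setminus\{[0],[1]\}$ of the least possible size; (ii) for every vertex $v\in V(\varTheta(R))\setminus D$ there is an edge in $\varTheta(R)$ with source $v$ and target in $D$; (iii) for every vertex $v\in V(\varTheta(R))\setminus D$ there is an edge in $\varTheta(R)$ with target $v$ and source in $D$.
   Context: For a finite unital ring $R$, define $a\sim b$ if and only if $a=bu=vb$ for some units $u,v\in R$; this is an equivalence relation, and $[a]$ denotes the class of $a$. $\varTheta(R)$ is the directed graph whose vertices are the classes $[a]$, $a\in R$, with a directed edge $[x]\to[y]$ ($[x]$, $[y]$ not necessarily distinct) if and only if $xy=0$ (this is well defined). $\overline{\varTheta}(R)$ is the undirected graph with the same vertices, in which $[x]$ and $[y]$ (not necessarily distinct) are joined by an edge if and only if $xy=0$ or $yx=0$. $V(G)$ denotes the vertex set of a graph $G$. Removing a set of vertices from a graph means passing to the subgraph induced on the remaining vertices. A dominating set in an undirected graph $G$ is a subset $D\subseteq V(G)$ such that every vertex of $G$ is in $D$ or is adjacent to at least one vertex in $D$. $\binom{n}{1}_q=\frac{q^n-1}{q-1}$ is the number of $1$-dimensional subspaces of $F_q^n$.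
   Formalization: In (ii) and (iii) the vertex v = [1] is excluded: an edge between [1] and d in either direction forces d = [0], which is not in D by (i), so the claim fails for v = [1]. *)

(* Defs.v *)
From HB Require Import structures.
From mathcomp Require Import all_boot all_order all_algebra.

Set Implicit Arguments.
Unset Strict Implicit.
Unset Printing Implicit Defensive.

Import GRing.Theory.
Local Open Scope ring_scope.
Local Open Scope quotient_scope.

Section Theta.
Variable R : finUnitRingType.

Definition unit_equiv : rel R := fun a b =>
  [exists u : R, exists v : R,
    [&& u \is a GRing.unit, v \is a GRing.unit, a == b * u & a == v * b]].

Lemma unit_equivP a b :
  reflect (exists u v, [/\ u \is a GRing.unit, v \is a GRing.unit,
                           a = b * u & a = v * b])
          (unit_equiv a b).
Proof.
apply: (iffP existsP) => [[u /existsP[v /and4P[uU vU /eqP au /eqP av]]]|].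
  by exists u, v.
move=> [u [v [uU vU au av]]]; exists u; apply/existsP; exists v.
by apply/and4P; split => //; apply/eqP.
Qed.

Lemma unit_equiv_refl : reflexive unit_equiv.
Proof.
by move=> a; apply/unit_equivP; exists 1, 1; rewrite !unitr1 mulr1 mul1r.
Qed.

Lemma unit_equiv_sym : symmetric unit_equiv.
Proof.
suff imp a b : unit_equiv a b -> unit_equiv b a.
  by move=> a b; apply/idP/idP; apply: imp.
move=> /unit_equivP[u [v [uU vU au av]]]; apply/unit_equivP.
exists u^-1, v^-1; rewrite !unitrV; split => //.
- by rewrite au mulrK.
- by rewrite av mulKr.
Qed.

Lemma unit_equiv_trans : transitive unit_equiv.
Proof.
move=> b a c /unit_equivP[u [v [uU vU au av]]].
move=> /unit_equivP[u' [v' [uU' vU' bu bv]]]; apply/unit_equivP.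
exists (u' * u), (v * v'); rewrite !unitrMl //; split => //.
- by rewrite au bu mulrA.
- by rewrite av bv mulrA.
Qed.

Canonical unit_equiv_equiv :=
  EquivRel unit_equiv unit_equiv_refl unit_equiv_sym unit_equiv_trans.

(* The common vertex type of the directed and the undirected graph. *)
Definition theta := {eq_quot unit_equiv}.

HB.instance Definition _ := EqQuotient.on theta.
HB.instance Definition _ : isCountable theta := CanIsCountable (@reprK _ theta).
HB.instance Definition _ : isFinite theta := CanIsFinite (@reprK _ theta).

Definition theta_class (a : R) : theta := \pi_theta a.

Definition theta_edge : rel theta := fun X Y => repr X * repr Y == 0.

Lemma theta_classP a b :
  reflect (exists u v, [/\ u \is a GRing.unit, v \is a GRing.unit,
                           a = b * u & a = v * b])
          (theta_class a == theta_class b).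
Proof. by rewrite /theta_class eqmodE; apply: unit_equivP. Qed.

Lemma theta_edgeE x y :
  theta_edge (theta_class x) (theta_class y) = (x * y == 0).
Proof.
rewrite /theta_edge.
have /theta_classP[_ [v [_ vU _ ->]]] :
  theta_class (repr (theta_class x)) == theta_class x.
  by rewrite /theta_class reprK.
have /theta_classP[u [_ [uU _ -> _]]] :
  theta_class (repr (theta_class y)) == theta_class y.
  by rewrite /theta_class reprK.
rewrite mulrA -(mulrA v); apply/eqP/eqP => [xy0|->]; last by rewrite mulr0 mul0r.
by apply/(mulrI vU)/(mulIr uU); rewrite xy0 mulr0 mul0r.
Qed.

Definition theta_bar_edge : rel theta :=
  fun X Y => theta_edge X Y || theta_edge Y X.

End Theta.

(* D is a dominating set of the subgraph induced on W by the undirected graph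
   with vertex type T and symmetric adjacency relation e (loops allowed). *)
Definition dominating_set (T : finType) (e : rel T) (W D : {set T}) : Prop :=
  D \subset W /\
  forall v, v \in W -> v \in D \/ exists2 d, d \in D & e v d.

Definition minimum_dominating_set (T : finType) (e : rel T) (W D : {set T}) :
    Prop :=
  dominating_set e W D /\
  forall D', dominating_set e W D' -> (#|D| <= #|D'|)%N.

(* The Gaussian binomial (n choose 1)_q; the division is exact for q > 1. *)
Definition gauss_binom1 (n q : nat) : nat := ((q ^ n - 1) %/ (q - 1))%N.

(* Main.v *)
Require Import Defs.
From HB Require Import structures.
From mathcomp Require Import all_boot all_order all_algebra.

Set Implicit Arguments.
Unset Strict Implicit.
Unset Printing Implicit Defensive.

Import GRing.Theory.
Local Open Scope ring_scope.

(* The class of A is determined by the kernel and the image of A.  The set D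
   consists of the classes [x^T x], one for each line <x>: a singular A
   annihilates some x <> 0 on either side, hence also x^T x.  Conversely, let D'
   be dominating.  A vertex V of rank n - 1 with y V = 0 and V x^T = 0 is
   dominated only by itself, by the nonzero d with rows in <y>, and by the
   nonzero d with columns in <x^T>.  If every line <y> contains the rows of some
   d in D', this gives a surjection from a subset of D' onto lines.  Otherwise
   fix a failing y and let x vary: for every line <x>, D' contains either some d
   with columns in <x^T>, or some d of rank n - 1 with d x^T = 0.  Such a d
   determines <x>, the two kinds being told apart by the rank since n >= 3. *)

(** By the second hypothesis [d] determines [f x] whenever [P x d], so a map from [B] reaches all of
    [f @: A]. *)
Lemma card_imset_le_rel (X T U : finType) (f : X -> T) (A : {set X})
    (B : {set U}) (P : X -> U -> bool) :
    (forall x, x \in A -> exists2 d, d \in B & P x d) ->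
    (forall x y d, x \in A -> y \in A -> P x d -> P y d -> f x = f y) ->
  (#|f @: A| <= #|B|)%N.
Proof.
move=> exP Pf; have [-> | [x0 _]] := set_0Vmem A.
  by rewrite imset0 cards0.
(* The default [x0] serves only those [d] that are related to no point of [A]. *)
pose g d := f (odflt x0 [pick x in A | P x d]).
apply: leq_trans (leq_imset_card g B); apply/subset_leq_card/subsetP.
move=> _ /imsetP[x xA ->]; have [d dB Pxd] := exP x xA.
apply/imsetP; exists d => //; rewrite /g.
case: pickP => [y /andP[yA Pyd] | /(_ x)]; last by rewrite xA Pxd.
exact: Pf Pxd Pyd.
Qed.

(** * Lines, kernels and outer products of row vectors *)

Section RowVectors.
Variables (F : fieldType) (n : nat).
Implicit Types (x y : 'rV[F]_n) (A V : 'M[F]_n).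

Lemma row_nz_submx_sym x y : x != 0 -> (x <= y)%MS -> (y <= x)%MS.
Proof.
move=> x0 /sub_rVP[a xE]; move: x0; rewrite xE scaler_eq0 negb_or => /andP[a0 _].
by rewrite (eqmx_scale _ a0).
Qed.

(** A nonzero row of [A] spans both lines. *)
Lemma submx_rows_eq A x y :
  A != 0 -> (A <= x)%MS -> (A <= y)%MS -> (x <= y)%MS.
Proof.
move=> A0 Ax; apply: submx_trans.
by apply: submx_trans (row_nz_submx_sym _ (submx_trans (nz_row_sub A) Ax))
  (nz_row_sub A); rewrite nz_row_eq0.
Qed.

(** The left kernel of [V] has dimension 1, so the nonzero vector [x] spans it. *)
Lemma corank1_kernel m V x (A : 'M[F]_(m, n)) :
  x != 0 -> \rank V = n.-1 -> x *m V = 0 -> A *m V = 0 -> (A <= x)%MS.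
Proof.
move=> x0 rV /eqP xV /eqP AV.
have xK : (x <= kermx V)%MS by apply/sub_kermxP/eqP.
have : (A <= kermx V)%MS by apply/sub_kermxP/eqP.
move/submx_trans; apply.
rewrite -(geq_leqif (mxrank_leqif_sup xK)) mxrank_ker rV rank_rV x0.
by case: n {x A V x0 rV xV AV xK} => // k; rewrite subSnn.
Qed.

Lemma rV_pid_mx x : x != 0 ->
  exists2 P : 'M[F]_n, P \in unitmx & (x <= (pid_mx 1 : 'rV_n) *m P)%MS.
Proof.
move=> x0; exists (row_ebase x); first exact: row_ebase_unit.
rewrite -{1}(mulmx_ebase x) rank_rV x0 -mulmxA; exact: submxMl.
Qed.

Lemma exists_corank1 x y : x != 0 -> y != 0 ->
  exists V, [/\ \rank V = n.-1, y *m V = 0 & V *m x^T = 0].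
Proof.
move=> x0 y0; have [P uP /submxP[a xE]] := rV_pid_mx x0.
have [Q uQ /submxP[b yE]] := rV_pid_mx y0.
have n0 : (0 < n)%N by case: n x x0 {y y0 P uP a xE Q uQ b yE} => // x;
  rewrite thinmx0 eqxx.
have uPT : invmx P^T \in unitmx by rewrite unitmx_inv unitmx_tr.
have uQV : invmx Q \in unitmx by rewrite unitmx_inv.
(* [P] and [Q] carry the first basis vector onto the lines of [x] and [y]; [copid_mx 1] has rank
   [n - 1] and kills that vector on both sides. *)
exists (invmx Q *m copid_mx 1 *m invmx P^T); split.
- rewrite mxrankMfree ?row_free_unit // (eqmxMfull _ _) ?row_full_unit //.
  by rewrite rank_copid_mx // subn1.
- rewrite yE -!mulmxA mulKVmx // (mulmxA (pid_mx 1)).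
  by rewrite mul_pid_mx_copid // mul0mx mulmx0.
- rewrite xE !trmx_mul -!mulmxA mulKmx ?unitmx_tr // tr_pid_mx.
  by rewrite (mulmxA (copid_mx 1)) mul_copid_mx_pid // mul0mx mulmx0.
Qed.

Lemma nonunit_left_kernel A :
  A \notin unitmx -> exists2 x : 'rV_n, x != 0 & x *m A = 0.
Proof.
rewrite -row_free_unit -kermx_eq0 => K0; exists (nz_row (kermx A)).
  by rewrite nz_row_eq0.
by apply/sub_kermxP/nz_row_sub.
Qed.

Lemma rank_outer_le1 x y : (\rank (x^T *m y) <= 1)%N.
Proof. exact: leq_trans (mxrankM_maxl _ _) (rank_leq_col _). Qed.

Lemma outer_eq0 x y : (x^T *m y == 0) = (x == 0) || (y == 0).
Proof.
have [->|x0] /= := eqVneq x 0; first by rewrite trmx0 mul0mx eqxx.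
have [->|y0] /= := eqVneq y 0; first by rewrite mulmx0 eqxx.
rewrite -mxrank_eq0 mxrankMfree ?mxrank_tr ?rank_rV ?x0 //.
by rewrite /row_free rank_rV y0.
Qed.

End RowVectors.

(** * The classes of rank-one symmetric squares and their number *)

Section OuterClasses.
Variables (F : finFieldType) (m : nat).
Local Notation M := 'M[F]_m.+1.
Implicit Types (x y : 'rV[F]_m.+1) (A B : M) (v : theta M).

Definition outer_class x : theta M := theta_class (x^T *m x : M).

Lemma theta_class_repr v : theta_class (repr v) = v.
Proof. exact: reprK. Qed.

Lemma theta_class_eq0 A : (theta_class A == theta_class 0) = (A == 0).
Proof.
apply/idP/eqP => [/theta_classP[u [w [_ _ -> _]]] | -> //].
by rewrite mul0r.
Qed.

Lemma theta_class_eq1 A : (theta_class A == theta_class 1) = (A \in unitmx).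
Proof.
apply/theta_classP/idP => [[u [w [uU _ -> _]]] | AU]; first by rewrite mul1r.
by exists A, A; rewrite mulr1 mul1r; split.
Qed.

Lemma theta_edge_reprr A v :
  theta_edge (theta_class A) v = (A *m repr v == 0).
Proof. by rewrite -{1}(theta_class_repr v) theta_edgeE. Qed.

Lemma theta_edge_reprl A v :
  theta_edge v (theta_class A) = (repr v *m A == 0).
Proof. by rewrite -{1}(theta_class_repr v) theta_edgeE. Qed.

Lemma theta_class_rank A B :
  theta_class A = theta_class B -> \rank A = \rank B.
Proof.
move=> /eqP/theta_classP[u [_ [uU _ -> _]]].
by rewrite mxrankMfree // row_free_unit.
Qed.

Lemma outer_class_submx x y :
  x != 0 -> (x <= y)%MS -> outer_class x = outer_class y.
Proof.
move=> x0 /sub_rVP[a xE]; have a0 : a != 0.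
  by apply: contraNneq x0 => a0; rewrite xE a0 scale0r.
have uU : (a * a)%:M \in @unitmx F m.+1.
  by rewrite unitmxE det_scalar unitrX // unitfE mulf_neq0.
apply/eqP/theta_classP; exists (a * a)%:M, (a * a)%:M; split => //.
- by rewrite -mulmxE mul_mx_scalar xE -scalemxAr linearZ /= -scalemxAl scalerA.
- by rewrite -mulmxE mul_scalar_mx xE -scalemxAr linearZ /= -scalemxAl scalerA.
Qed.

(** As a left multiple of [y^T *m y], the nonzero matrix [x^T *m x] has its rows in both lines. *)
Lemma outer_class_inj x y :
  x != 0 -> outer_class x = outer_class y -> (x <= y)%MS.
Proof.
move=> x0 /eqP/theta_classP[_ [w [_ _ _ E]]].
apply: (@submx_rows_eq _ _ (x^T *m x)).
- by rewrite outer_eq0 negb_or x0.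
- exact: submxMl.
- by rewrite E -mulmxE mulmxA submxMl.
Qed.

Definition outer_classes : {set theta M} := outer_class @: [set x | x != 0].

(** The nonzero vectors are counted class by class: each class collects the [#|F| - 1] nonzero
    multiples of one vector. *)
Lemma card_outer_classes : #|outer_classes| = gauss_binom1 m.+1 #|F|.
Proof.
have q1 : (1 < #|F|)%N by exact: card_finNzRing_gt1.
have fib v : v \in outer_classes ->
    #|[set x in [set x | x != 0] | outer_class x == v]| = (#|F| - 1)%N.
  case/imsetP=> x; rewrite inE => x0 ->.
  have inj : injective (fun a : F => a *: x).
    move=> a b /eqP; rewrite -subr_eq0 -scalerBl scaler_eq0 (negPf x0) orbF.
    by rewrite subr_eq0 => /eqP.
  rewrite subn1 -(cardC1 (0 : F)) -(card_imset _ inj); apply: eq_card => y.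
  rewrite !inE; apply/andP/imsetP => [[y0 /eqP yx] | [a a0 ->]].
    have /sub_rVP[a yE] := outer_class_inj y0 yx; exists a => //.
    by rewrite inE; apply: contraNneq y0 => a0; rewrite yE a0 scale0r.
  rewrite !inE in a0; have ax0 : a *: x != 0 by rewrite scaler_eq0 negb_or a0.
  by split=> //; apply/eqP/outer_class_submx => //; apply: scalemx_sub.
have cX : #|[set x : 'rV[F]_m.+1 | x != 0]| = (#|F| ^ m.+1 - 1)%N.
  by rewrite cardsE cardC1 card_mx mul1n subn1.
rewrite /gauss_binom1 -cX -[#|[set x | _]|]sum1_card.
rewrite (partition_big outer_class (mem outer_classes)) /=; last first.
  by move=> x xX; apply: imset_f.
rewrite (eq_bigr (fun=> (#|F| - 1)%N)) => [|v vD]; last first.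
  by rewrite -(fib v vD) -sum1_card; apply: eq_bigl => x; rewrite !inE.
by rewrite sum_nat_const mulnK // subn_gt0.
Qed.

(** * Domination by these classes and the lower bound *)

Lemma theta_neq1_nonunit v : v != theta_class 1 -> repr v \notin unitmx.
Proof. by rewrite -{1}(theta_class_repr v) theta_class_eq1. Qed.

Lemma outer_classes_target v : v != theta_class 1 ->
  exists2 d, d \in outer_classes & theta_edge v d.
Proof.
move=> /theta_neq1_nonunit; rewrite -unitmx_tr => /nonunit_left_kernel[x x0 xV].
exists (outer_class x); first by apply: imset_f; rewrite inE.
rewrite theta_edge_reprl mulmxA -[_ *m x^T]trmxK trmx_mul trmxK xV.
by rewrite trmx0 mul0mx.
Qed.

Lemma outer_classes_source v : v != theta_class 1 ->
  exists2 d, d \in outer_classes & theta_edge d v.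
Proof.
move=> /theta_neq1_nonunit/nonunit_left_kernel[x x0 xV].
exists (outer_class x); first by apply: imset_f; rewrite inE.
by rewrite theta_edge_reprr -mulmxA xV mulmx0.
Qed.

Local Notation W := (~: [set theta_class (0 : M); theta_class (1 : M)]).

Lemma outer_classes_dominating : (2 <= m.+1)%N ->
  dominating_set (@theta_bar_edge M) W outer_classes.
Proof.
move=> m1; split.
  apply/subsetP=> _ /imsetP[x + ->]; rewrite !inE => x0.
  rewrite theta_class_eq0 theta_class_eq1 outer_eq0 (negPf x0) /=.
  rewrite -row_free_unit /row_free.
  by apply: contraTneq m1 => <-; rewrite -leqNgt rank_outer_le1.
move=> v; rewrite !inE negb_or => /andP[_ v1]; right.
have [d dD vd] := outer_classes_target v1.
by exists d; rewrite // /theta_bar_edge vd.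
Qed.

(** The choice of [repr] does not matter here and below: equivalent matrices share their row space
    and column space, hence also their rank and kernels. *)
Definition rows_in v x := (repr v != 0) && (repr v <= x)%MS.
Definition cols_in v x := (repr v != 0) && ((repr v)^T <= x)%MS.
Definition corank1_ann v x := (\rank (repr v) == m) && (repr v *m x^T == 0).

(** For the matrix [V] of [exists_corank1], [V *m d = 0] forces the columns of [d] into the line of
    [x^T], and [d *m V = 0] forces its rows into that of [y]. The third alternative is the class of
    [V] itself. *)
Lemma dominating_corank1 (D : {set theta M}) x y :
    (2 <= m)%N -> dominating_set (@theta_bar_edge M) W D ->
    x != 0 -> y != 0 ->
  exists2 d, d \in D & [|| rows_in d y, cols_in d x | corank1_ann d x].
Proof.
move=> m2 [DW domD] x0 y0; have [V [rV yV Vx]] := exists_corank1 x0 y0.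
have nz d : d \in D -> repr d != 0.
  move/(subsetP DW); rewrite !inE negb_or -{1}(theta_class_repr d).
  by rewrite theta_class_eq0 => /andP[].
have VW : theta_class (V : M) \in W.
  rewrite !inE theta_class_eq0 theta_class_eq1 negb_or -mxrank_eq0.
  by rewrite -row_free_unit /row_free rV /= -lt0n (ltnW m2) neq_ltn ltnSn.
have [VD | [d dD /orP[]]] := domD _ VW.
- exists (theta_class (V : M)) => //; apply/or3P/Or33.
  rewrite /corank1_ann (theta_class_rank (theta_class_repr _)) rV eqxx /=.
  have /eqP/theta_classP[_ [w [_ _ _ ->]]] :=
    theta_class_repr (theta_class (V : M)).
  by rewrite -mulmxE -mulmxA Vx mulmx0.
- rewrite theta_edge_reprr => /eqP Vd; exists d => //; apply/or3P/Or32.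
  rewrite /cols_in nz //=; apply: (@corank1_kernel _ _ _ V^T).
  + exact: x0.
  + by rewrite mxrank_tr.
  + by rewrite -[x]trmxK -trmx_mul Vx trmx0.
  + by rewrite -trmx_mul Vd trmx0.
- rewrite theta_edge_reprl => /eqP dV; exists d => //; apply/or3P/Or31.
  by rewrite /rows_in nz //=; apply: corank1_kernel yV dV.
Qed.

Lemma outer_classes_min (D : {set theta M}) :
    (2 <= m)%N -> dominating_set (@theta_bar_edge M) W D ->
  (#|outer_classes| <= #|D|)%N.
Proof.
move=> m2 domD.
have [/forallP allH | ] := boolP [forall y : 'rV_m.+1,
    (y != 0) ==> [exists d in D, rows_in d y]].
  apply: (@card_imset_le_rel _ _ _ _ _ _ (fun y d => rows_in d y)).
    move=> y; rewrite inE => y0.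
    by have /existsP[d /andP[dD dy]] := implyP (allH y) y0; exists d.
  move=> x y d; rewrite !inE => x0 y0 /andP[d0 dx] /andP[_ dy].
  exact: outer_class_submx x0 (submx_rows_eq d0 dx dy).
rewrite negb_forall => /existsP[y]; rewrite negb_imply negb_exists.
case/andP=> y0 /forallP noD.
(* With [y] fixed so that no [d] in [D] has its rows in its line, only the other two alternatives
   remain for each [x]. *)
apply: (@card_imset_le_rel _ _ _ _ _ _
  (fun x d => cols_in d x || corank1_ann d x)).
  move=> x; rewrite inE => x0.
  have [d dD /orP[dy | dx]] := dominating_corank1 m2 domD x0 y0.
    by have := noD d; rewrite dD dy.
  by exists d.
(* Columns in a line give rank at most 1, whereas [corank1_ann] gives rank [m], which is at least
   2. *)
have disj d x y' : cols_in d x -> corank1_ann d y' -> False.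
  case/andP=> _ dx /andP[/eqP rd _]; have := mxrankS dx.
  by rewrite mxrank_tr rd => /leq_trans/(_ (rank_leq_row _)); rewrite leqNgt m2.
move=> x z d; rewrite !inE => x0 z0 /orP[] dx /orP[] dz.
- case/andP: dx dz => d0 dx /andP[_ dz]; apply: outer_class_submx => //.
  by apply: (@submx_rows_eq _ _ (repr d)^T); rewrite // trmx_eq0.
- by case: (disj _ _ _ dx dz).
- by case: (disj _ _ _ dz dx).
(* Both [x^T] and [z^T] lie in the one-dimensional right kernel of [repr d]. *)
- case/andP: dx dz => /eqP rd /eqP dx /andP[_ /eqP dz].
  apply: outer_class_submx => //.
  apply: (@corank1_kernel _ _ _ (repr d)^T); rewrite ?mxrank_tr //.
  + by rewrite -[z]trmxK -trmx_mul dz trmx0.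
  + by rewrite -[x]trmxK -trmx_mul dx trmx0.
Qed.

End OuterClasses.

(* The ring structure on square matrices needs a size in successor form, so
   the size n >= 3 is written m.+1.  The class [1] is excluded in (ii) and
   (iii): its only neighbour is [0], which does not lie in D by (i). *)
Theorem proposition3p9 (m q : nat) (F : finFieldType)
    (hn : (3 <= m.+1)%N) (hq : #|F| = q) :
  exists D : {set theta 'M[F]_m.+1},
    [/\ #|D| = gauss_binom1 m.+1 q,
        minimum_dominating_set (@theta_bar_edge 'M[F]_m.+1)
          (~: [set theta_class (0 : 'M[F]_m.+1); theta_class (1 : 'M[F]_m.+1)])
          D,
        forall v : theta 'M[F]_m.+1,
          v \notin D -> v != theta_class (1 : 'M[F]_m.+1) ->
          exists2 d, d \in D & theta_edge v d
      & forall v : theta 'M[F]_m.+1,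
          v \notin D -> v != theta_class (1 : 'M[F]_m.+1) ->
          exists2 d, d \in D & theta_edge d v].
Proof.
exists (outer_classes F m); split.
- by rewrite card_outer_classes hq.
- split; first exact/outer_classes_dominating/ltnW.
  by move=> D; apply: outer_classes_min.
- by move=> v _; apply: outer_classes_target.
- by move=> v _; apply: outer_classes_source.
Qed.
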